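(* Let $q$ be a prime power, let $s,m\ge1$ be integers and $\mathbf{e}\in\mathbb{N}^s$. Let a system $\{\mathbf{c}^{(i)}_j\in\mathbb{F}_q^m:1\le j\le m,\ 1\le i\le s\}$ be given, let $C_i$ ($1\le i\le s$) be the $m\times m$ matrix with column vectors $\mathbf{c}^{(i)}_1,\dots,\mathbf{c}^{(i)}_m$, let $C=(C_1\mid C_2\mid\cdots\mid C_s)\in\mathbb{F}_q^{m\times sm}$, let $\mathcal{C}\subseteq\mathbb{F}_q^{sm}$ be the row space of $C$ and $\mathcal{C}^\perp$ its dual space. Let $d\in\{0,\dots,m\}$ be an integer. Then: (a) If the system is a $(d,m,\mathbf{e},s)$-system over $\mathbb{F}_q$, then $\delta_{m,\mathbf{e}}(\mathcal{C}^\perp)\ge d$. (b) If the matrices $C_1,\dots,C_s$ are all nonsingular and the system is a $(d,m,\mathbf{e},s)$-system over $\mathbb{F}_q$, then $\delta_{m,\mathbf{e}}(\mathcal{C}^\perp)\ge d+1$. (c) If $\delta_{m,\mathbf{e}}(\mathcal{C}^\perp)\ge d+1$, then the system is a $(d,m,\mathbf{e},s)$-system over $\mathbb{F}_q$.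
   Context: $\mathbb{N}$ denotes the positive integers. For $\mathbf{e}=(e_1,\dots,e_s)\in\mathbb{N}^s$ and $0\le d\le m$, a system $\{\mathbf{a}^{(i)}_j\in\mathbb{F}_q^m:1\le i\le s,1\le j\le m\}$ is a $(d,m,\mathbf{e},s)$-system over $\mathbb{F}_q$ if for any nonnegative integers $d_1,\dots,d_s$ with $e_i\mid d_i$ for all $i$ and $\sum_i d_i\le d$, the vectors $\mathbf{a}^{(i)}_j$, $1\le j\le d_i$, $1\le i\le s$, are linearly independent over $\mathbb{F}_q$ (trivially satisfied for $d=0$). The dual space of $\mathcal{C}$ is its orthogonal complement with respect to the standard dot product on $\mathbb{F}_q^{sm}$. For $\mathbf{a}=(a_1,\dots,a_m)\in\mathbb{F}_q^m$ and $e\in\mathbb{N}$, $v_e(\mathbf{a})=0$ if $\mathbf{a}=\mathbf{0}$ and $v_e(\mathbf{a})=\min\{m,e\lceil\max\{j:a_j\neq0\}/e\rceil\}$ otherwise. For $\mathbf{A}=(\mathbf{a}^{(1)},\dots,\mathbf{a}^{(s)})\in\mathbb{F}_q^{sm}$ with $\mathbf{a}^{(i)}\in\mathbb{F}_q^m$, $V_{m,\mathbf{e}}(\mathbf{A})=\sum_{i=1}^sv_{e_i}(\mathbf{a}^{(i)})$. For a linear subspace $\mathcal{N}\subseteq\mathbb{F}_q^{sm}$, $\delta_{m,\mathbf{e}}(\mathcal{N})=\min_{\mathbf{A}\in\mathcal{N}\setminus\{\mathbf{0}\}}V_{m,\mathbf{e}}(\mathbf{A})$ if $\mathcal{N}\neq\{\mathbf{0}\}$,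 and $sm+1$ otherwise. *)

(* Defs.v *)
From mathcomp Require Import all_boot all_order all_algebra.
Set Implicit Arguments.
Unset Strict Implicit.
Unset Printing Implicit Defensive.
Import Order.TTheory GRing.Theory Num.Theory.
Local Open Scope ring_scope.

(* The finite field F_q is an arbitrary F : finFieldType, with q = #|F|.
   The indices 1 <= i <= s and 1 <= j <= m are the ordinals 'I_s and
   'I_m, shifted down by one.  F_q^(sm) is 'rV[F]_(\sum_(i < s) m), the type on
   which the block operations \mxrow and submxrow act; the block a^(i) of A is
   submxrow A i. *)

(* [free] is a predicate on sequences, so a repeated vector in the family makes
   it dependent. *)
Definition is_system (F : finFieldType) (s m d : nat) (e : 'I_s -> nat)
    (a : 'I_s -> 'I_m -> 'cV[F]_m) : Prop :=
  forall k : 'I_s -> nat,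
    (forall i, (e i %| k i)%N) -> (\sum_(i < s) k i <= d)%N ->
    free [seq a p.1 p.2 | p in [pred p : 'I_s * 'I_m | (p.2 < k p.1)%N]].

Definition system_block (F : finFieldType) (s m : nat)
    (c : 'I_s -> 'I_m -> 'cV[F]_m) (i : 'I_s) : 'M[F]_m :=
  \matrix_(r < m, j < m) c i j r 0.

Definition system_mx (F : finFieldType) (s m : nat)
    (c : 'I_s -> 'I_m -> 'cV[F]_m) : 'M[F]_(m, \sum_(i < s) m) :=
  \mxrow_(i < s) system_block c i.

Definition row_space (F : finFieldType) (m n : nat) (M : 'M[F]_(m, n)) :
    {vspace 'rV[F]_n} :=
  <<[seq row i M | i : 'I_m]>>%VS.

Definition dual_space (F : finFieldType) (n : nat) (U : {vspace 'rV[F]_n}) :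
    {vspace 'rV[F]_n} :=
  (\bigcap_(u : 'rV[F]_n | u \in U) lker (linfun (mulmxr u^T)))%VS.

Lemma mem_dual_space (F : finFieldType) (n : nat) (U : {vspace 'rV[F]_n})
    (v : 'rV[F]_n) :
  reflect (forall u, u \in U -> \sum_(j < n) v 0 j * u 0 j = 0)
          (v \in dual_space U).
Proof.
rewrite memvE; apply: (iffP subv_bigcapP) => h u Uu.
  have:= h u Uu; rewrite -memvE memv_ker lfunE /= => /eqP/matrixP/(_ 0 0).
  by rewrite !mxE; apply: etrans; apply: eq_bigr => j _; rewrite mxE.
rewrite -memvE memv_ker lfunE /=; apply/eqP/matrixP => i j.
rewrite !ord1 !mxE; apply: etrans (h u Uu).
by apply: eq_bigr => l _; rewrite mxE.
Qed.

(* The ordinal j : 'I_m stands for the 1-based index j.+1. *)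
Definition last_nz (F : finFieldType) (m : nat) (a : 'rV[F]_m) : nat :=
  \max_(j < m | a 0%R j != 0%R) j.+1.

Definition v_weight (F : finFieldType) (m e : nat) (a : 'rV[F]_m) : nat :=
  if a == 0 then 0%N
  else minn m (e * absz (Num.ceil ((last_nz a)%:R / e%:R : rat))).

Definition V_weight (F : finFieldType) (s m : nat) (e : 'I_s -> nat)
    (A : 'rV[F]_(\sum_(i < s) m)) : nat :=
  (\sum_(i < s) v_weight (e i) (submxrow A i))%N.

(* [vpick N] only witnesses that N contains a nonzero vector. *)
Definition min_dist (F : finFieldType) (s m : nat) (e : 'I_s -> nat)
    (N : {vspace 'rV[F]_(\sum_(i < s) m)}) : nat :=
  if N == 0%VS then (s * m).+1
  else V_weight e
    [arg min_(A < vpick N | (A \in N) && (A != 0%R)) V_weight e A]%N.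

(* Main.v *)
Require Import Defs.
From mathcomp Require Import all_boot all_order all_algebra.
Set Implicit Arguments.
Unset Strict Implicit.
Unset Printing Implicit Defensive.
Import Order.TTheory GRing.Theory Num.Theory.
Local Open Scope ring_scope.

(* An element of the dual space is exactly a tuple of coefficients of a linear
   dependence between the vectors c i j, so the system condition says that the
   dual space has no nonzero element A whose blocks have their last nonzero
   coordinates bounded by multiples k i of e i with sum at most d.  For such an
   A one has V(A) <= d, which gives (c).  Conversely, the weight of each block
   is itself an admissible bound, being a multiple of e i unless it is equal to
   m.  In the latter case V(A) >= m >= d, which gives (a); equality forces A to
   be supported on a single block, which is impossible if that block of the
   matrix is nonsingular, whence (b). *)

(** Indexing the coefficients by all of [T], with zeros off [P], instead of by positions in an
    enumeration of [P], lets a dependence be read as a vector of the ambient space. *)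
Lemma free_imageP (K : fieldType) (vT : vectType K) (T : finType)
    (P : {pred T}) (f : T -> vT) :
  reflect (forall x : T -> K, (forall t, t \notin P -> x t = 0) ->
             \sum_t x t *: f t = 0 -> forall t, x t = 0)
          (free [seq f t | t in P]).
Proof.
apply: (iffP (@freeP _ _ _ (image_tuple f P))) => free_f.
  move=> x xP0 sum0 t; have [Pt|/xP0//] := boolP (t \in P).
  rewrite -(enum_rankK_in Pt Pt).
  apply: (free_f (fun i => x (enum_val i))); rewrite -[RHS]sum0.
  rewrite [RHS](bigID (mem P)) /= [X in _ = _ + X]big1 ?addr0; last first.
    by move=> u /xP0 ->; rewrite scale0r.
  rewrite (big_enum_val (fun t => x t *: f t)).
  by apply: eq_bigr => i _; rewrite nth_image.
move=> k sum0 i.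
(* Extension of [k] by zero; [enum_rank_in] needs a witness that [P] is inhabited, which the
   membership proof [Pt] supplies. *)
pose x t := if (t \in P) =P true is ReflectT Pt
            then k (enum_rank_in Pt t) else 0.
have xE j : x (enum_val j) = k j.
  rewrite /x; case: eqP => [Pt|]; last by rewrite enum_valP.
  by rewrite enum_valK_in.
have xP0 t : t \notin P -> x t = 0.
  by move=> nPt; rewrite /x; case: eqP => // Pt; rewrite Pt in nPt.
rewrite -xE; apply: free_f => //.
rewrite (bigID (mem P)) /= [X in _ + X]big1 ?addr0; last first.
  by move=> u /xP0 ->; rewrite scale0r.
rewrite (big_enum_val (fun t => x t *: f t)) -[RHS]sum0.
by apply: eq_bigr => j _; rewrite nth_image xE.
Qed.

(** Orthogonality to the rows suffices: the vectors orthogonal to [v] form a kernel, and a kernel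
    containing the rows contains their span. *)
Lemma mem_dual_row_space (F : finFieldType) (m n : nat) (M : 'M[F]_(m, n))
    (v : 'rV[F]_n) :
  (v \in dual_space (row_space M)) = (M *m v^T == 0).
Proof.
apply/mem_dual_space/eqP => [v_dual|Mv0].
  apply/matrixP => i j; rewrite !ord1 !mxE.
  have Mi : row i M \in row_space M by apply/memv_span/image_f.
  rewrite -[RHS](v_dual _ Mi).
  by apply: eq_bigr => l _; rewrite !mxE mulrC.
have sMK : (row_space M <= lker (linfun (mulmxr v^T)))%VS.
  apply/span_subvP => _ /imageP[i _ ->].
  by rewrite memv_ker lfunE /= -row_mul Mv0 row0.
move=> u /(subvP sMK); rewrite memv_ker lfunE /= => /eqP/matrixP/(_ 0 0).
rewrite !mxE; apply: etrans; apply: eq_bigr => l _.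
by rewrite mxE mulrC.
Qed.

Lemma system_mx_mul (F : finFieldType) (s m : nat)
    (c : 'I_s -> 'I_m -> 'cV[F]_m) (A : 'rV[F]_(\sum_(i < s) m)) :
  system_mx c *m A^T = \sum_(i < s) system_block c i *m (submxrow A i)^T.
Proof. by rewrite -{1}[A]submxrowK tr_mxrow mul_mxrow_mxcol. Qed.

Lemma system_block_mul (F : finFieldType) (s m : nat)
    (c : 'I_s -> 'I_m -> 'cV[F]_m) (i : 'I_s) (a : 'rV[F]_m) :
  system_block c i *m a^T = \sum_(j < m) a 0 j *: c i j.
Proof.
apply/matrixP => r l; rewrite !ord1 !mxE summxE.
by apply: eq_bigr => j _; rewrite !mxE mulrC.
Qed.

Lemma last_nz_leP (F : finFieldType) (m k : nat) (a : 'rV[F]_m) :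
  reflect (forall j : 'I_m, (k <= j)%N -> a 0 j = 0) (last_nz a <= k)%N.
Proof.
apply: (iffP (bigmax_leqP _ _ _)) => a0 j.
  by move=> kj; apply: contraTeq kj => /a0; rewrite ltnNge.
by apply: contraNT; rewrite -ltnNge ltnS => /a0 ->.
Qed.

Lemma last_nz_le_size (F : finFieldType) (m : nat) (a : 'rV[F]_m) :
  (last_nz a <= m)%N.
Proof. by apply/last_nz_leP => j; rewrite leqNgt ltn_ord. Qed.

Lemma last_nz_le0 (F : finFieldType) (m : nat) (a : 'rV[F]_m) :
  (last_nz a <= 0)%N = (a == 0).
Proof.
apply/last_nz_leP/eqP => [a0|-> j _]; last by rewrite mxE.
by apply/rowP => j; rewrite a0 // mxE.
Qed.

(** The adjunction between ceiling and inclusion of integers, used to replace the rational ceiling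
    by natural arithmetic. The absolute value is harmless as the ceiling is nonnegative. *)
Lemma absz_ceil_div_le (n e k : nat) : (0 < e)%N ->
  (absz (Num.ceil (n%:R / e%:R : rat)) <= k)%N = (n <= e * k)%N.
Proof.
move=> e_gt0; rewrite -lez_nat gez0_abs; last first.
  by rewrite ceil_ge0 (lt_le_trans (ltrN10 _)) ?divr_ge0.
by rewrite ceil_le_int ler_pdivrMr ?ltr0n // -natrM ler_nat mulnC.
Qed.

Section BlockWeight.

Variables (F : finFieldType) (m e : nat).
Hypothesis e_gt0 : (0 < e)%N.
Implicit Type a : 'rV[F]_m.

Lemma last_nz_le_weight a : (last_nz a <= v_weight e a)%N.
Proof.
rewrite /v_weight; have [->|_] := eqVneq a 0; first by rewrite last_nz_le0.
by rewrite leq_min last_nz_le_size -absz_ceil_div_le ?leqnn.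
Qed.

(** Writing [k] as [e * l], the hypothesis bounds the ceiling by [l]; the cap at [m] can only lower
    the weight. *)
Lemma v_weight_le a k : (e %| k)%N -> (last_nz a <= k)%N ->
  (v_weight e a <= k)%N.
Proof.
move=> /dvdnP[l ->]; rewrite mulnC /v_weight -absz_ceil_div_le // => a_le.
by case: eqP => // _; rewrite geq_min leq_mul2l a_le !orbT.
Qed.

Lemma dvdn_v_weight a : (v_weight e a < m)%N -> (e %| v_weight e a)%N.
Proof.
rewrite /v_weight; case: eqP => // _; rewrite gtn_min ltnn /= => lt_m.
by rewrite (minn_idPr (ltnW lt_m)) dvdn_mulr.
Qed.

Lemma v_weight_eq0 a : v_weight e a = 0%N -> a = 0.
Proof.
by move=> a0; apply/eqP; rewrite -last_nz_le0 -a0 last_nz_le_weight.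
Qed.

End BlockWeight.

(** The bound on [d] serves the zero space, where the right-hand side is vacuous and [min_dist] is
    [(s * m).+1]. *)
Lemma leq_min_distP (F : finFieldType) (s m d : nat) (e : 'I_s -> nat)
    (N : {vspace 'rV[F]_(\sum_(i < s) m)}) : (d <= (s * m).+1)%N ->
  reflect (forall A, A \in N -> A != 0 -> (d <= V_weight e A)%N)
          (d <= min_dist e N)%N.
Proof.
move=> d_le; rewrite /min_dist; have [->|N0] := eqVneq N 0%VS.
  by rewrite d_le; left => A; rewrite memv0 => ->.
case: arg_minnP => [|A /andP[NA A0] minA]; first by rewrite memv_pick vpick0.
apply: (iffP idP) => [d_leA B NB B0|]; last exact.
by apply: leq_trans d_leA (minA B _); rewrite NB.
Qed.

Section System.

Variables (F : finFieldType) (s m : nat) (e : 'I_s -> nat).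
Variable c : 'I_s -> 'I_m -> 'cV[F]_m.
Implicit Types (d : nat) (A : 'rV[F]_(\sum_(i < s) m)).

Local Notation dual := (dual_space (row_space (system_mx c))).

Lemma submxrow_eq0 A : (forall i, submxrow A i = 0) -> A = 0.
Proof.
move=> A0; rewrite -[A]submxrowK -[RHS]submxrowK.
by apply: eq_mxrow => i; rewrite A0; apply/matrixP => r j; rewrite !mxE.
Qed.

Lemma mem_dual_system A :
  (A \in dual) = (\sum_i \sum_j submxrow A i 0 j *: c i j == 0).
Proof.
rewrite mem_dual_row_space system_mx_mul.
by under eq_bigr do rewrite system_block_mul.
Qed.

(** The blocks of [A] hold the coefficients of a dependence, and their vanishing outside the
    selected vectors is the bound on [last_nz]. *)
Lemma is_systemP d :
  is_system d e c <->
  (forall k : 'I_s -> nat, (forall i, (e i %| k i)%N) ->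
     (\sum_(i < s) k i <= d)%N ->
     forall A, A \in dual -> (forall i, last_nz (submxrow A i) <= k i)%N ->
     A = 0).
Proof.
split=> sys k ek kd.
  move=> A; rewrite mem_dual_system => /eqP sum0 Ak.
  have /free_imageP/(_ (fun p => submxrow A p.1 0 p.2)) x0 := sys k ek kd.
  apply: submxrow_eq0 => i; apply/rowP => j; rewrite [RHS]mxE.
  apply: (x0 _ _ (i, j)) => [[i' j']|]; last by rewrite -[RHS]sum0 pair_big.
  by rewrite inE /= -leqNgt; apply/last_nz_leP.
apply/free_imageP => x xk0 sum0 [i j].
pose A := \mxrow_(i < s) \row_(j < m) x (i, j).
have AE i' j' : submxrow A i' 0 j' = x (i', j') by rewrite mxrowK mxE.
suff A0 : A = 0 by rewrite -AE A0 !mxE.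
apply: (sys k ek kd) => [|i'].
  rewrite mem_dual_system pair_big -[X in _ == X]sum0; apply/eqP.
  by apply: eq_bigr => -[i' j'] _; rewrite AE.
apply/last_nz_leP => j' kj'; rewrite AE xk0 // inE /=.
by rewrite -leqNgt.
Qed.

Hypothesis e_gt0 : forall i, (0 < e i)%N.

(** Otherwise every block weight is below [m], hence a multiple of [e i], and the weights themselves
    are admissible bounds forcing [A = 0]. *)
Lemma is_system_large_weight d A :
  is_system d e c -> A \in dual -> A != 0 -> (V_weight e A <= d)%N ->
  exists i, (m <= v_weight (e i) (submxrow A i))%N.
Proof.
move=> /is_systemP sys dualA A0 wA; apply/existsP; apply: contraNT A0.
rewrite negb_exists => /forallP small; apply/eqP.
apply: (sys (fun i => v_weight (e i) (submxrow A i))) => // i.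
  by apply: dvdn_v_weight => //; rewrite ltnNge.
exact: last_nz_le_weight.
Qed.

Lemma v_weight_le_V_weight A i :
  (v_weight (e i) (submxrow A i) <= V_weight e A)%N.
Proof. by rewrite /V_weight (bigD1 i) //= leq_addr. Qed.

Lemma is_system_weight_ge d A : (d <= m)%N ->
  is_system d e c -> A \in dual -> A != 0 -> (d <= V_weight e A)%N.
Proof.
move=> d_le_m sys dualA A0; have [wA|/ltnW//] := leqP (V_weight e A) d.
have [i mi] := is_system_large_weight sys dualA A0 wA.
exact: leq_trans d_le_m (leq_trans mi (v_weight_le_V_weight A i)).
Qed.

Lemma is_system_weight_gt d A : (d <= m)%N ->
  (forall i, system_block c i \in unitmx) ->
  is_system d e c -> A \in dual -> A != 0 -> (d < V_weight e A)%N.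
Proof.
move=> d_le_m unitC sys dualA A0; rewrite ltnNge.
apply: contra_neqN A0 => wA; have [//|A0] := eqVneq A 0.
have [i mi] := is_system_large_weight sys dualA A0 wA.
(* Block [i] alone has weight at least [m], while the total is at most [d <= m], so nothing remains
   for block [j]. *)
have other0 j : j != i -> submxrow A j = 0.
  move=> ji; apply/(v_weight_eq0 (e_gt0 j))/eqP; rewrite -leqn0.
  rewrite -(leq_add2l m) addn0; apply: leq_trans (leq_trans wA d_le_m).
  rewrite /V_weight (bigD1 i) //= (bigD1 j) //= addnA.
  by apply: leq_trans (leq_addr _ _); rewrite leq_add2r.
apply: submxrow_eq0 => j; have [->|/other0//] := eqVneq j i.
(* Only the term of block [i] survives in the product, and the invertible [system_block c i]
   cancels. *)
move: dualA; rewrite mem_dual_row_space system_mx_mul (bigD1 i) //= big1.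
  rewrite addr0 => /eqP Ci0; apply: trmx_inj.
  by rewrite -(mulKmx (unitC i) (submxrow A i)^T) Ci0 mulmx0 trmx0.
by move=> l /other0 ->; rewrite trmx0 mulmx0.
Qed.

Lemma weight_gt_is_system d :
  (forall A, A \in dual -> A != 0 -> (d < V_weight e A)%N) ->
  is_system d e c.
Proof.
move=> wt; apply/is_systemP => k ek kd A dualA Ak; apply/eqP.
apply: contraT => /(wt A dualA); rewrite ltnNge (leq_trans _ kd) //.
by apply: leq_sum => i _; apply: v_weight_le.
Qed.

End System.

Theorem theorem6 (F : finFieldType) (s m : nat) (e : 'I_s -> nat)
    (c : 'I_s -> 'I_m -> 'cV[F]_m) (d : nat)
    (s_ge1 : (1 <= s)%N) (m_ge1 : (1 <= m)%N)
    (e_ge1 : forall i, (1 <= e i)%N) (d_le_m : (d <= m)%N) :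
  [/\ is_system d e c ->
        (d <= min_dist e (dual_space (row_space (system_mx c))))%N,
      (forall i, system_block c i \in unitmx) -> is_system d e c ->
        (d.+1 <= min_dist e (dual_space (row_space (system_mx c))))%N
    & (d.+1 <= min_dist e (dual_space (row_space (system_mx c))))%N ->
        is_system d e c].
Proof.
(* This uses [s >= 1] and gives the side condition of [leq_min_distP] for [d.+1], covering a zero
   dual space. *)
have d_le_sm : (d <= s * m)%N by rewrite (leq_trans d_le_m) ?leq_pmull.
split=> [sys|unitC sys|].
- by apply/leq_min_distP => [|A]; [exact: leqW | exact: is_system_weight_ge].
- by apply/leq_min_distP => // A; exact: is_system_weight_gt.
- by move/leq_min_distP => /(_ d_le_sm); exact: weight_gt_is_system.
Qed.
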